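(* Let $J\subset\mathbb R$ be an interval, let $\alpha_1,\dots,\alpha_m\colon J\to\mathbb R$ be continuous functions linearly independent on $J$, let $A_1,\dots,A_m$ be pairwise commuting real constant $n\times n$ matrices, and let $B_j=A_j^{T}$. Suppose $\nu^{k}$, $k=1,\dots,m+1$, are common real eigenvectors of the matrices $B_j$ corresponding to the eigenvalues $\lambda^{j}_k$, i.e. $B_j\nu^{k}=\lambda^{j}_k\nu^{k}$, $j=1,\dots,m$, $k=1,\dots,m+1$. Let the real numbers $h_1,\dots,h_{m+1}$ be a nontrivial solution of the linear system $$\sum_{k=1}^{m+1}\lambda^{j}_k\,h_k=0,\quad j=1,\dots,m.$$ Then the (Lappo-Danilevskii) system $\dfrac{dx}{dt}=\sum_{j=1}^{m}\alpha_j(t)A_jx$ has the autonomous first integral $$F\colon x\mapsto\prod_{k=1}^{m+1}|\nu^{k}x|^{h_k}\quad\text{for all }x\in\mathscr X,$$ where $\mathscr X\subset\mathbb R^n$ is any domain on which $F$ is defined and continuously differentiable.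
   Context: A domain is an open arcwise connected set. For a vector $\nu=(\nu_1,\dots,\nu_n)$ and $x\in\mathbb R^n$, $\nu x=\sum_{\xi=1}^n\nu_\xi x_\xi$; eigenvectors are non-zero and regarded as columns when multiplied by $B_j$. An autonomous first integral on $\mathscr X$ of $dx/dt=\sum_j\alpha_j(t)A_jx$ is a continuously differentiable function $F\colon\mathscr X\to\mathbb R$ with $\sum_{j=1}^m\alpha_j(t)\sum_{\xi=1}^n(A_jx)_\xi\,\partial_{x_\xi}F(x)=0$ for all $(t,x)\in J\times\mathscr X$. *)

(* Defs.v *)
From HB Require Import structures.
From mathcomp Require Import all_boot all_order all_algebra.
From mathcomp Require Import all_classical all_reals all_analysis.
Set Implicit Arguments.
Unset Strict Implicit.
Unset Printing Implicit Defensive.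
Import Order.TTheory GRing.Theory Num.Theory.
Import numFieldNormedType.Exports.
Local Open Scope classical_set_scope.
Local Open Scope ring_scope.

Definition arcwise_connected (R : realType) (T : topologicalType)
    (X : set T) : Prop :=
  forall x y, X x -> X y -> exists g : R -> T,
    [/\ {within `[0, 1], continuous g}, g 0 = x, g 1 = y
      & forall t, t \in `[0, 1] -> X (g t)].

Definition domain (R : realType) (n : nat) (X : set 'cV[R]_n) : Prop :=
  open X /\ arcwise_connected R X.

Definition lin_indep_on (R : realType) (J : set R) (m : nat)
    (alpha : 'I_m -> R -> R) : Prop :=
  forall c : 'I_m -> R,
    (forall t, J t -> \sum_j c j * alpha j t = 0) -> forall j, c j = 0.

Definition partial (R : realType) (n : nat) (i : 'I_n)
    (F : 'cV[R]_n -> R) (x : 'cV[R]_n) : R :=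
  'D_(delta_mx i 0) F x.

(* Used for open X only, so that the values of F outside X are irrelevant. *)
Definition continuously_differentiable_on (R : realType) (n : nat)
    (X : set 'cV[R]_n) (F : 'cV[R]_n -> R) : Prop :=
  (forall x, X x -> differentiable F x) /\
  (forall i, {within X, continuous (partial i F)}).

(* F is an autonomous first integral on X of the linear system
   dx/dt = \sum_j alpha_j(t) A_j x, t in J. *)
Definition autonomous_first_integral (R : realType) (n m : nat) (J : set R)
    (alpha : 'I_m -> R -> R) (A : 'I_m -> 'M[R]_n) (X : set 'cV[R]_n)
    (F : 'cV[R]_n -> R) : Prop :=
  continuously_differentiable_on X F /\
  forall t x, J t -> X x ->
    \sum_j alpha j t * \sum_xi (A j *m x) xi 0 * partial xi F x = 0.

Definition linear_form (R : realType) (n : nat) (nu x : 'cV[R]_n) : R :=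
  \sum_xi nu xi 0 * x xi 0.

Definition prod_powers (R : realType) (n p : nat) (nu : 'I_p -> 'cV[R]_n)
    (h : 'I_p -> R) (x : 'cV[R]_n) : R :=
  \prod_k `|linear_form (nu k) x| `^ (h k).

(* The library's power is total, with 0 `^ a = 0 for a < 0, where the real
   power is undefined; 0 `^ 0 = 1 and 0 `^ a = 0 for a > 0 are kept. *)
Definition prod_powers_defined (R : realType) (n p : nat)
    (nu : 'I_p -> 'cV[R]_n) (h : 'I_p -> R) (x : 'cV[R]_n) : Prop :=
  forall k, linear_form (nu k) x = 0 -> 0 <= h k.

(* Main.v *)
Require Import Defs.
From HB Require Import structures.
From mathcomp Require Import all_boot all_order all_algebra.
From mathcomp Require Import all_classical all_reals all_analysis.
Set Implicit Arguments.
Unset Strict Implicit.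
Unset Printing Implicit Defensive.
Import Order.TTheory GRing.Theory Num.Theory.
Import numFieldNormedType.Exports.
Local Open Scope classical_set_scope.
Local Open Scope ring_scope.

(* If A^T nu = lambda nu, then nu (x + s A x) = (1 + s lambda) nu x.  Hence
   along the line s |-> x + s A_j x the product F is F x times
   \prod_k |1 + s lambda^j_k| `^ h_k, whose derivative at s = 0 is
   \sum_k lambda^j_k h_k = 0.  The factorization also holds where some nu^k x
   vanishes, so zeros of F need no separate treatment. *)

(** The differential is linear in the direction, which is expanded in the standard basis. *)
Lemma derive_sum_partial (R : realType) (n : nat) (F : 'cV[R]_n -> R)
    (x v : 'cV[R]_n) :
  differentiable F x -> 'D_v F x = \sum_xi v xi 0 * partial xi F x.
Proof.
move=> dF; rewrite deriveE//.
have -> : v = \sum_xi v xi 0 *: delta_mx xi 0.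
  by rewrite {1}[v]matrix_sum_delta; apply: eq_bigr => i _; rewrite big_ord1.
rewrite linear_sum; apply: eq_bigr => i _.
rewrite linearZ /= /partial deriveE//; congr (_ * _).
(* The expansion also replaced [v] inside the coefficients on the right, so its entry [i] is read
   off again. *)
rewrite summxE (bigD1 i)//= !mxE !eqxx mulr1 big1 ?addr0// => k ki.
by rewrite !mxE eq_sym (negbTE ki) mulr0.
Qed.

Lemma linear_formDl (R : realType) (n : nat) (nu x y : 'cV[R]_n) (s : R) :
  linear_form nu (s *: x + y) = s * linear_form nu x + linear_form nu y.
Proof.
rewrite /linear_form mulr_sumr -big_split; apply: eq_bigr => i _ /=.
by rewrite !mxE mulrDr mulrCA.
Qed.

Lemma linear_form_mulmx (R : realType) (n : nat) (A : 'M[R]_n)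
    (nu x : 'cV[R]_n) (l : R) :
  A^T *m nu = l *: nu -> linear_form nu (A *m x) = l * linear_form nu x.
Proof.
have E (u w : 'cV[R]_n) : linear_form u w = (u^T *m w) 0 0.
  by rewrite mxE; apply: eq_bigr => i _; rewrite mxE.
move=> eig; rewrite !E mulmxA -[u in u *m x]trmxK trmx_mul trmxK eig.
by rewrite linearZ/= -scalemxAl mxE.
Qed.

(** Logarithmic differentiation: near [s = 0] every base is positive, so the product is the
    exponential of the sum of the [h k * ln (1 + s * l k)]. *)
Lemma is_derive_prod_linear_powers (R : realType) (p : nat) (l h : 'I_p -> R) :
  is_derive (0 : R) (1 : R) (fun s : R => \prod_k `|1 + s * l k| `^ h k)
    (\sum_k l k * h k).
Proof.
pose g k (s : R) : R := h k * ln (1 + s * l k).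
have dg k : is_derive (0 : R) (1 : R) (g k) (l k * h k).
  have da : is_derive (0 : R) (1 : R) (fun s : R => 1 + s * l k) (l k).
    have -> : (fun s : R => 1 + s * l k) = cst 1 + l k \*: id.
      by apply/funext => s; rewrite /= mulrC.
    by apply: is_derive_eq; rewrite add0r scaler1.
  have d1 : is_derive (1 + 0 * l k) (1 : R) (@ln R) 1.
    by rewrite mul0r addr0 -[X in is_derive _ _ _ X]invr1; exact: is_derive1_ln.
  have dc := is_deriveZ (h k) (is_derive1_comp (g := fun s => 1 + s * l k) d1 da).
  by apply: is_derive_eq dc _; rewrite mul1r [RHS]mulrC.
(* The exponent vanishes at [s = 0], so the outer factor in the chain rule is [expR 0 = 1]. *)
have d1 : is_derive ((\sum_k g k) 0) (1 : R) (@expR R) 1.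
  rewrite fct_sumE big1 => [|k _]; last by rewrite /g mul0r addr0 ln1 mulr0.
  by rewrite -[X in is_derive _ _ _ X]expR0; exact: is_derive_expR.
have := is_derive1_comp d1 (is_derive_sum dg); rewrite mul1r.
apply: near_eq_is_derive.
(* There are finitely many [k], so one neighbourhood of 0 serves them all. *)
have pos : \forall s \near (0 : R), forall k, 0 < 1 + s * l k.
  suff pos1 k : \forall s \near (0 : R), 0 < 1 + s * l k by exact: filter_forall pos1.
  have : (1 + s * l k @[s --> (0 : R)]) --> 1 + 0 * l k.
    by apply: cvgD; [exact: cvg_cst|apply: cvgMr_tmp; exact: cvg_id].
  by rewrite mul0r addr0 => /cvgr_gt; apply; exact: ltr01.
near=> s.
rewrite /= fct_sumE expR_sum; apply: eq_bigr => k _.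
have lt0 : 0 < 1 + s * l k by move: k; near: s.
by rewrite /g gtr0_norm// /powR gt_eqF.
Unshelve. all: by end_near. Qed.

Lemma derive_prod_powers_eigen (R : realType) (n p : nat)
    (nu : 'I_p -> 'cV[R]_n) (h l : 'I_p -> R) (x v : 'cV[R]_n) :
    (forall k, linear_form (nu k) v = l k * linear_form (nu k) x) ->
  'D_v (prod_powers nu h) x = prod_powers nu h x * \sum_k l k * h k.
Proof.
move=> eig.
pose G (s : R) := \prod_k `|1 + s * l k| `^ h k.
have FG s : prod_powers nu h (s *: v + x) = prod_powers nu h x * G s.
  rewrite /prod_powers -big_split; apply: eq_bigr => k _ /=.
  rewrite linear_formDl eig mulrA -{2}[linear_form _ x]mul1r -mulrDl addrC.
  (* Multiplicativity of the power holds for all nonnegative bases, zero included, whatever the sign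
     of the exponent. *)
  by rewrite normrM mulrC powRM.
have G0 : G 0 = 1.
  by rewrite /G big1// => k _; rewrite mul0r addr0 normr1 powR1.
have [dG <-] := is_derive_prod_linear_powers l h.
rewrite /derive; apply: cvg_lim => //.
(* Since [G 0 = 1], the difference quotient of the product along [v] is exactly its value at [x]
   times that of [G] at 0. *)
rewrite [X in X @ _ --> _](_ : _ = fun s => prod_powers nu h x *
    (s^-1 *: ((G \o shift 0) (s *: 1) - G 0))); first exact: cvgMl_tmp.
apply/funext => s; rewrite /= FG G0 addr0 /GRing.scale /= mulr1.
by rewrite -[X in _ * (_ - X)]mulr1 -mulrBr mulrCA.
Qed.

Theorem theorem2p8 (R : realType) (n m : nat) (J : set R)
    (alpha : 'I_m -> R -> R) (A : 'I_m -> 'M[R]_n)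
    (nu : 'I_m.+1 -> 'cV[R]_n) (lambda : 'I_m -> 'I_m.+1 -> R)
    (h : 'I_m.+1 -> R)
    (J_interval : is_interval J)
    (alpha_cont : forall j, {within J, continuous (alpha j)})
    (alpha_indep : lin_indep_on J alpha)
    (A_comm : forall i j, A i *m A j = A j *m A i)
    (nu_neq0 : forall k, nu k != 0)
    (nu_eigen : forall j k, (A j)^T *m nu k = lambda j k *: nu k)
    (h_nontrivial : exists k, h k != 0)
    (h_sol : forall j, \sum_k lambda j k * h k = 0)
    (X : set 'cV[R]_n)
    (X_domain : domain X)
    (F_defined : forall x, X x -> prod_powers_defined nu h x)
    (F_C1 : continuously_differentiable_on X (prod_powers nu h)) :
  autonomous_first_integral J alpha A X (prod_powers nu h).
Proof.
(* Each summand vanishes by itself: its inner sum is the derivative of the product in the direction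
   [A j *m x]. *)
split=> // t x _ Xx; apply: big1 => j _.
rewrite -derive_sum_partial; last exact: F_C1.1.
rewrite (derive_prod_powers_eigen _ (l := lambda j)) => [|k].
  by rewrite h_sol !mulr0.
exact: linear_form_mulmx.
Qed.
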